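(* Let $\mathcal{X}$ be a Banach space of analytic functions on $\mathbb{D}$ such that (i) $\mathcal{F}\subseteq\mathcal{X}$, and (ii) for every disk automorphism $\phi\in\mathrm{Aut}(\mathbb{D})$, the composition operator $C_\phi$ is bounded on $\mathcal{X}$ and $\rho(C_\phi)=1$. Let $\varphi$ be a hyperbolic disk automorphism. Then the spectrum of $C_\varphi$ acting on $\mathcal{X}$ is the unit circle: $\sigma(C_\varphi)=\partial\mathbb{D}$.
   Context: $\mathbb{D}=\{z\in\mathbb{C}:|z|<1\}$ and $\partial\mathbb{D}$ is the unit circle. $\mathrm{Aut}(\mathbb{D})$ is the group of analytic bijections of $\mathbb{D}$, i.e. the maps $z\mapsto\lambda\frac{a-z}{1-\overline{a}z}$ with $|\lambda|=1$, $a\in\mathbb{D}$. A disk automorphism is hyperbolic if, as a Möbius map of the Riemann sphere, it has exactly two fixed points, which are distinct and both lie on $\partial\mathbb{D}$. A Banach space of analytic functions on $\mathbb{D}$ is a complex vector space of analytic functions $\mathbb{D}\to\mathbb{C}$ (with pointwise operations) that is complete under a given norm. For an analytic self-map $\varphi$ of $\mathbb{D}$, $C_\varphi f=f\circ\varphi$. For a bounded operator $T$ on $\mathcal{X}$, $\sigma(T)=\{\lambda\in\mathbb{C}:T-\lambda I\text{ is not invertible}\}$ and $\rho(T)=\sup\{|\lambda|:\lambda\in\sigma(T)\}$. The family $\mathcal{F}$ is the union of: the functions $f_s(z)=\exp\left(\frac{s(z+1)}{z-1}\right)$ for real $s\ge 0$; the functions $f_t(z)=\left(\frac{1+z}{1-z}\right)^{it}=\exp\left(it\log\frac{1+z}{1-z}\right)$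 for $t\in\mathbb{R}$ ($\log$ the principal branch); and the monomials $z^k$ for $k\in\mathbb{N}=\{1,2,\dots\}$. *)

(* Defs.v *)
From HB Require Import structures.
From mathcomp Require Import all_boot all_order all_algebra.
From mathcomp Require Import all_classical all_reals all_analysis.
From mathcomp Require Export complex.
Export numFieldNormedType.Exports.
Set Implicit Arguments.
Unset Strict Implicit.
Unset Printing Implicit Defensive.
Import Order.TTheory GRing.Theory Num.Theory.
Local Open Scope classical_set_scope.
Local Open Scope ring_scope.

Definition modulus (R : realType) (z : R[i]) : R := complex.Re `|z|.

Definition unit_circle (R : realType) : set R[i] := [set z | `|z| = 1].
Arguments unit_circle : clear implicits.

Definition cexp (R : realType) (z : R[i]) : R[i] :=
  (expR (complex.Re z))%:C%C *
  Complex (cos (complex.Im z)) (sin (complex.Im z)).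

(* Principal argument, with values in ]-pi, pi], of a nonzero number. *)
Definition carg (R : realType) (z : R[i]) : R :=
  if 0 <= complex.Im z then acos (complex.Re z / modulus z)
  else - acos (complex.Re z / modulus z).

(* Principal branch of the logarithm; its value at 0 is irrelevant. *)
Definition clog (R : realType) (z : R[i]) : R[i] :=
  Complex (ln (modulus z)) (carg z).

Definition disk (R : realType) : Type := {z : R[i] | `|z| < 1}.

(* As the disk is open, the value 0 taken outside it does not affect the
   derivative at a point of the disk. *)
Definition extend0 (R : realType) (f : disk R -> R[i]) (z : R[i]) : R[i] :=
  oapp f 0 (insub z).

Definition analytic (R : realType) (f : disk R -> R[i]) : Prop :=
  forall z : disk R, derivable (extend0 f : R[i]^o -> R[i]^o) (val z) 1.

Definition disk_aut (R : realType) (phi : disk R -> disk R) : Prop :=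
  bijective phi /\ analytic (fun z => val (phi z)).

(* The Riemann sphere is the one-point compactification of R[i], with point at
   infinity None. *)
Definition moebius (R : realType) (a b c d : R[i])
    (w : one_point_compactification R[i]) : one_point_compactification R[i] :=
  match w with
  | Some z => if c * z + d == 0 then None else Some ((a * z + b) / (c * z + d))
  | None => if c == 0 then None else Some (a / c)
  end.

(* The Moebius map extending phi to the sphere is unique, since it is
   determined by its values on the disk. *)
Definition hyperbolic (R : realType) (phi : disk R -> disk R) : Prop :=
  exists a b c d : R[i],
    [/\ a * d - b * c != 0,
        forall z : disk R, moebius a b c d (Some (val z)) = Some (val (phi z))
      & exists p q : R[i],
          [/\ p <> q, unit_circle R p, unit_circle R q
            & [set w | moebius a b c d w = w] = [set Some p; Some q]]].

(* A vector space of functions is given by its carrier together with the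
   injective linear map sending each element to the function it is; the norm is
   arbitrary, and point evaluations need not be continuous. *)
Record banachAnalyticSpace (R : realType) := BanachAnalyticSpace {
  carrier :> completeNormedModType R[i];
  fun_of : {linear carrier -> (disk R -> R[i]^o)};
  fun_of_inj : injective fun_of;
  fun_of_analytic : forall f : carrier, analytic (fun_of f)
}.

Definition member (R : realType) (X : banachAnalyticSpace R) :
    set (disk R -> R[i]) :=
  range (fun_of X).

Definition comp_stable (R : realType) (X : banachAnalyticSpace R)
    (phi : disk R -> disk R) : Prop :=
  forall f : disk R -> R[i], member X f -> member X (f \o phi).

(* The composition operator; meaningful when X is stable under composition with
   phi, in which case the choice is unique by injectivity of fun_of. *)
Definition comp_op (R : realType) (X : banachAnalyticSpace R)
    (phi : disk R -> disk R) (f : X) : X :=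
  xget 0 [set g : X | fun_of X g = fun_of X f \o phi].
Arguments comp_op {R} X phi f.

Definition bounded_operator (R : realType) (X : normedModType R[i])
    (T : X -> X) : Prop :=
  linear T /\ bounded_near T (nbhs (0 : X)).

Definition invertible_operator (R : realType) (X : normedModType R[i])
    (T : X -> X) : Prop :=
  exists S : X -> X, [/\ bounded_operator S, cancel T S & cancel S T].

Definition spectrum (R : realType) (X : normedModType R[i]) (T : X -> X) :
    set R[i] :=
  [set l | ~ invertible_operator (fun x => T x - l *: x)].

(* Real supremum: it is 0 on empty or unbounded sets, so spectral_radius T = 1
   implies that the spectrum is nonempty and bounded. *)
Definition spectral_radius (R : realType) (X : normedModType R[i])
    (T : X -> X) : R :=
  sup [set modulus l | l in spectrum T].

Definition exp_fun (R : realType) (s : R) (z : disk R) : R[i] :=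
  cexp (s%:C%C * (val z + 1) / (val z - 1)).

Definition pow_fun (R : realType) (t : R) (z : disk R) : R[i] :=
  cexp ('i%C * t%:C%C * clog ((1 + val z) / (1 - val z))).

Definition monomial_fun (R : realType) (k : nat) (z : disk R) : R[i] :=
  val z ^+ k.

Definition calF (R : realType) : set (disk R -> R[i]) :=
  [set exp_fun s | s in [set s : R | 0 <= s]] `|`
  range (@pow_fun R) `|`
  [set monomial_fun (R := R) k | k in [set k : nat | (0 < k)%N]].
Arguments calF : clear implicits.

(* Main.v *)
From HB Require Import structures.
Require Import Defs.
From mathcomp Require Import all_boot all_order all_algebra.
From mathcomp Require Import all_classical all_reals all_analysis.
From mathcomp Require Import ring lra.
Set Implicit Arguments.
Unset Strict Implicit.
Unset Printing Implicit Defensive.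
Import Order.TTheory GRing.Theory Num.Theory.
Local Open Scope classical_set_scope.
Local Open Scope ring_scope.

(* A nonzero l lies in sigma(T) iff 1/l lies in sigma(T^-1). The operator C_phi
   and its inverse C_(phi^-1) both have spectral radius 1, so sigma(C_phi) is
   contained in the unit circle. Conversely, let p and q be the fixed points of
   phi. The Moebius map W sending p to 0, q to infinity and the disk onto the
   right half-plane satisfies W o phi = m W; as multiplication by m preserves
   the half-plane, m is a positive real, and m <> 1 as phi is not the identity.
   Writing W as the Cayley transform of a disk automorphism g, the function
   f_t o g = W^(it) belongs to X and is an eigenvector of C_phi for the
   eigenvalue m^(it), and these fill the circle as t varies. *)

(** * Spectra of a bounded operator and of its inverse *)

Lemma bounded_operatorP (R : realType) (X : normedModType R[i]) (T : X -> X) :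
  bounded_operator T <-> linear T /\ continuous T.
Proof.
split=> -[linT];
  pose L : {linear X -> X} := HB.pack T (GRing.isLinear.Build _ _ _ _ T linT);
  by split=> //; apply/(linear_bounded_continuous L).
Qed.

(* T - l = - l T (S - l^-1) when S is the inverse of T. *)
Lemma spectrum_inv (R : realType) (X : normedModType R[i]) (T S : X -> X)
    (l : R[i]) :
  bounded_operator T -> bounded_operator S -> cancel T S -> cancel S T ->
  l != 0 -> spectrum T l -> spectrum S l^-1.
Proof.
move=> /bounded_operatorP[linT _] /bounded_operatorP[linS cS] TK SK l0.
apply: contra_not => -[V [/bounded_operatorP[linV cV] UV VU]].
have SZ : scalable S := scalable_linear linS.
have TZ : scalable T := scalable_linear linT.
have VZ : scalable V := scalable_linear linV.
have [SB TB] := (zmod_morphism_linear linS, zmod_morphism_linear linT).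
exists (fun y => (- l^-1) *: V (S y)); split.
- apply/bounded_operatorP; split.
    by move=> a x y; rewrite linS linV scalerDr !scalerA mulrC.
  move=> x; apply: continuousZl_tmp.
  apply: continuous_comp; [exact: cS | exact: cV].
- move=> x; rewrite -VZ -[RHS]UV; congr V.
  by rewrite SB TK SZ scalerBr !scaleNr opprK scalerA mulVf // scale1r addrC.
- move=> y; rewrite -[RHS]SK -[in RHS](VU (S y)) TB !TZ SK !scaleNr scalerN
    opprK.
  by rewrite scalerA divff // scale1r addrC.
Qed.

Lemma modulusE (R : realType) (z : R[i]) : `|z| = (modulus z)%:C%C.
Proof. by rewrite /modulus normc_def. Qed.

Lemma spectral_radius_norm_le (R : realType) (X : normedModType R[i])
    (T : X -> X) (l : R[i]) :
  spectral_radius T = 1 -> spectrum T l -> `|l| <= 1.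
Proof.
rewrite /spectral_radius => T1 Tl.
have [ubT|noub] := pselect (has_ubound [set modulus l | l in spectrum T]);
  last first.
  (* [sup] is 0 on a set without upper bound, against the radius 1. *)
  by move: T1; rewrite sup_out => [/esym/eqP|[]//]; rewrite oner_eq0.
rewrite modulusE lecR -T1; apply: ub_le_sup => //.
by exists l.
Qed.

Lemma spectrum_sub_unit_circle (R : realType) (X : normedModType R[i])
    (T S : X -> X) :
  bounded_operator T -> bounded_operator S -> cancel T S -> cancel S T ->
  spectral_radius T = 1 -> spectral_radius S = 1 ->
  spectrum T `<=` unit_circle R.
Proof.
move=> bT bS TK SK T1 S1 l Tl; rewrite /unit_circle /=.
have l0 : l != 0.
  apply/eqP => l0; apply: Tl; exists S; split=> // x;
    by rewrite l0 scale0r subr0.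
apply/le_anti; rewrite (spectral_radius_norm_le T1 Tl) /=.
have := spectral_radius_norm_le S1 (spectrum_inv bT bS TK SK l0 Tl).
by rewrite normfV invf_le1 // normr_gt0.
Qed.

Lemma eigenvalue_spectrum (R : realType) (X : normedModType R[i])
    (T : X -> X) (l : R[i]) (x : X) :
  T 0 = 0 -> x != 0 -> T x = l *: x -> spectrum T l.
Proof.
move=> T0 x0 Tx [S [_ /can_inj injT _]]; move/eqP: x0; apply.
by apply: injT; rewrite T0 Tx scaler0 !subrr.
Qed.

(** * Composition operators *)

Lemma fun_of_comp_op (R : realType) (X : banachAnalyticSpace R)
    (phi : disk R -> disk R) (f : X) :
  comp_stable X phi -> fun_of X (comp_op X phi f) = fun_of X f \o phi.
Proof.
move=> /(_ (fun_of X f))[|g _ gE]; first by exists f.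
by rewrite /comp_op; case: xgetP => [_ -> //|/(_ g)].
Qed.

(** Composition operators multiply in reverse order, hence [cancel psi phi] and not
    [cancel phi psi]. *)
Lemma comp_op_cancel (R : realType) (X : banachAnalyticSpace R)
    (phi psi : disk R -> disk R) :
  comp_stable X phi -> comp_stable X psi -> cancel psi phi ->
  cancel (comp_op X phi) (comp_op X psi).
Proof.
move=> sphi spsi psiK f; apply: (@fun_of_inj _ X).
rewrite !fun_of_comp_op //; apply/funext => z /=.
by rewrite psiK.
Qed.

(** * Moebius maps, the disk and the right half-plane *)

Lemma moebius_analytic (R : realType) (f : disk R -> R[i]) (a b c d : R[i]) :
  (forall z : disk R, c * val z + d != 0) ->
  (forall z : disk R, f z = (a * val z + b) / (c * val z + d)) ->
  analytic f.
Proof.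
move=> den0 fE z.
pose m : R[i]^o -> R[i]^o := fun w => (a * w + b) * (c * w + d)^-1.
have aff : forall k l : R[i],
    derivable (fun w : R[i]^o => k * w + l : R[i]^o) (val z) 1.
  move=> k l; apply: (@derivableD _ _ _ (fun w : R[i]^o => k * w : R[i]^o)
    (cst l)) => //.
apply: (@near_eq_derivable _ _ _ m).
(* The ball of radius [1 - |z|] around [z] stays inside the disk, where [extend0 f] is the quotient
   [m]. *)
- near=> w.
  have w1 : `|w| < 1.
    near: w.
    apply/nbhs_normP; exists (1 - `|val z|).
      by rewrite /= subr_gt0 (valP z).
    move=> w /=; rewrite ltrBrDr => zw.
    by rewrite (le_lt_trans _ zw)// -[w in leLHS](subrK (val z)) -distrC
      ler_normD.
  rewrite /extend0 (insubT (fun z : R[i] => `|z| < 1) w1) /= fE //.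
- apply: (@derivableM _ _ (fun w : R[i]^o => a * w + b : R[i]^o)
    (fun w : R[i]^o => (c * w + d)^-1 : R[i]^o)) => //.
  apply: derivableV => //.
Unshelve. all: by end_near.
Qed.

(** The real part is [(1 - |u|^2) / |1 - u|^2]. *)
Lemma Re_cayley_gt0 (R : realType) (u : R[i]) :
  `|u| < 1 -> 0 < complex.Re ((1 + u) / (1 - u)).
Proof.
move=> u1.
have : `|u| ^+ 2 < 1 by rewrite expr_lt1.
rewrite -add_Re2_Im2; case: u u1 => a b u1 /=; rewrite ltcE /= eqxx /= => ab1.
have N : 0 < (1 - a) ^+ 2 + (0 - b) ^+ 2.
  have := sqr_ge0 (0 - b); have := sqr_ge0 b; rewrite expr2 in ab1; nra.
rewrite (_ : _ - _ = (1 - (a ^+ 2 + b ^+ 2)) / ((1 - a) ^+ 2 + (0 - b) ^+ 2)).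
  by rewrite divr_gt0 // subr_gt0.
rewrite sub0r sqrrN in N *; field; exact: lt0r_neq0.
Qed.

(** For [m = x + iy] the real part is [x - t y]: [t = 0] gives [x > 0], and [t = x / y] would make
    it vanish if [y] were nonzero. *)
Lemma gt0_of_half_plane (R : realType) (m : R[i]) :
  (forall t : R, 0 < complex.Re (m * Complex 1 t)) -> 0 < m.
Proof.
case: m => x y /= H; rewrite ltcE /=.
have x0 : 0 < x by have := H 0; rewrite mulr1 mulr0 subr0.
rewrite x0 andbT; apply: contraT => y0; have := H (x / y).
by rewrite mulr1 mulrCA divff // mulr1 subrr ltxx.
Qed.

(** The squared moduli of denominator and numerator differ by [(|a|^2 - |b|^2) (1 - |z|^2)], which
    is positive. *)
Lemma su11_norm_lt1 (C : numClosedFieldType) (l a b z : C) :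
  `|l| = 1 -> `|b| < `|a| -> `|z| < 1 ->
  (b^* * z + a^* != 0) && (`|l * (a * z + b) / (b^* * z + a^*)| < 1).
Proof.
move=> l1 ab z1.
have N : `|a * z + b| < `|b^* * z + a^*|.
  rewrite -(ltr_pXn2r (n := 2)) // ?nnegrE //.
  rewrite -subr_gt0 !normCK !(rmorphD, rmorphM) /= !conjCK.
  rewrite (_ : _ - _ = (a * a^* - b * b^*) * (1 - z * z^*)); last by ring.
  rewrite -!normCK mulr_gt0 // subr_gt0.
    by rewrite ltr_pXn2r // nnegrE.
  by rewrite expr_lt1.
have N0 := le_lt_trans (normr_ge0 _) N.
by rewrite -normr_gt0 N0 !normrM l1 mul1r normfV ltr_pdivrMr ?mul1r.
Qed.

(** * Complex exponential and principal logarithm *)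

Lemma cexpD (R : realType) (z w : R[i]) : cexp (z + w) = cexp z * cexp w.
Proof.
case: z w => [a b] [c d]; rewrite /cexp /= expRD cosD sinD; simpc.
apply/eqP; rewrite eq_complex /=; apply/andP; split; apply/eqP; ring.
Qed.

Lemma cexp_neq0 (R : realType) (z : R[i]) : cexp z != 0.
Proof.
apply/eqP => z0; have := cexpD z (- z).
rewrite z0 mul0r subrr /cexp /= expR0 cos0 sin0 => /eqP.
by rewrite mul1r eq_complex /= oner_eq0.
Qed.

(** A positive factor preserves the sign of the imaginary part and the ratio of real part to
    modulus, so [carg] does not change and no branch cut is crossed. *)
Lemma clogM (R : realType) (m : R) (w : R[i]) : 0 < m -> w != 0 ->
  clog (m%:C%C * w) = (ln m)%:C%C + clog w.
Proof.
move=> m0 w0.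
have M : modulus (m%:C%C * w) = m * modulus w.
  apply: complexI; rewrite rmorphM /= -!modulusE normrM.
  by congr (_ * _); rewrite ger0_norm // lecR ltW.
have W0 : 0 < modulus w by rewrite -ltcR -modulusE normr_gt0.
rewrite /clog M lnM ?posrE //; apply/eqP; rewrite eq_complex /= eqxx /= add0r.
apply/eqP; rewrite /carg M; case: w w0 M W0 => a b /= w0 M W0.
rewrite !mul0r subr0 addr0 pmulr_rge0 //.
by rewrite -mulf_div divff ?mul1r // gt_eqF.
Qed.

(** The angle is [acos a] or its opposite, by the sign of [b], since [sin (acos a)] only recovers
    [|b|]. *)
Lemma unit_circle_cexp (R : realType) (l : R[i]) :
  `|l| = 1 -> exists t : R, l = cexp ('i%C * t%:C%C).
Proof.
case: l => a b l1.
have ab1 : a ^+ 2 + b ^+ 2 = 1.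
  by apply: complexI; have := add_Re2_Im2 (Complex a b); rewrite l1 expr1n.
have a1 : -1 <= a <= 1 by apply/andP; split; nra.
have sE : sin (acos a) = `|b|.
  by rewrite sin_acos // -ab1 addrAC subrr add0r sqrtr_sqr.
have E (t : R) : cexp ('i%C * t%:C%C) = Complex (cos t) (sin t).
  by rewrite /cexp /= !mul0r mul1r oppr0 addr0 add0r expR0 rmorph1 !mul1r.
have [b0|b0] := lerP 0 b.
  by exists (acos a); rewrite E sE acosK // ger0_norm.
by exists (- acos a); rewrite E sinN cosN sE acosK // ltr0_norm // opprK.
Qed.

(** * Automorphisms of the disk *)

Lemma unit_conjV (C : numClosedFieldType) (z : C) : `|z| = 1 -> z^* = z^-1.
Proof. by move=> z1; rewrite invC_norm z1 expr1n invr1 mul1r. Qed.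

Lemma disk_neq_unit (R : realType) (q : R[i]) (z : disk R) :
  `|q| = 1 -> q - val z != 0.
Proof.
move=> q1; rewrite subr_eq0; apply/eqP => qz; have := valP z.
by rewrite -qz q1 ltxx.
Qed.

Lemma su11_disk_map (R : realType) (l a b : R[i]) :
  `|l| = 1 -> `|b| < `|a| ->
  exists2 g : disk R -> disk R, analytic (fun z => val (g z)) &
    forall z, b^* * val z + a^* != 0 /\
      val (g z) = l * (a * val z + b) / (b^* * val z + a^*).
Proof.
move=> l1 ab; have H (z : disk R) := andP (su11_norm_lt1 l1 ab (valP z)).
pose g (z : disk R) : disk R := exist (fun w : R[i] => `|w| < 1) _ (proj2 (H z)).
exists g; last by move=> z; split=> //; exact: (proj1 (H z)).
apply: (@moebius_analytic _ _ (l * a) (l * b) b^* a^*) => z.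
  exact: (proj1 (H z)).
by rewrite /= mulrDr mulrA.
Qed.

(** The inverse comes from the adjugate matrix. Free variables [a'] and [b'] replace the conjugates,
    which leaves a rational identity over any field. *)
Lemma su11_cancel (F : fieldType) (l a b a' b' z : F) :
  l != 0 -> a * a' - b * b' != 0 -> b' * z + a' != 0 ->
  let w := l * (a * z + b) / (b' * z + a') in
  l^-1 * (a' * w + - l * b) / (- l^-1 * b' * w + a) = z.
Proof.
move=> l0 ab0 z0 /=.
rewrite (_ : _ + a = (a * a' - b * b') / (b' * z + a')); last first.
  by field; rewrite z0.
rewrite [l^-1 * _](_ : _ = (a * a' - b * b') * z / (b' * z + a')).
  by field; rewrite ab0 z0.
by field; rewrite z0 l0.
Qed.

Lemma su11_cancelV (F : fieldType) (l a b a' b' z : F) :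
  l != 0 -> a * a' - b * b' != 0 -> - l^-1 * b' * z + a != 0 ->
  let w := l^-1 * (a' * z + - l * b) / (- l^-1 * b' * z + a) in
  l * (a * w + b) / (b' * w + a') = z.
Proof.
move=> l0 ab0 z0 /=.
(* The denominator of [w] times [l], in the shape of the side condition of [field]. *)
have z1 : - 1 * b' * z + a * l != 0.
  rewrite (_ : _ + _ = l * (- l^-1 * b' * z + a)) ?mulf_neq0 //.
  by field; rewrite l0.
rewrite [_ + a'](_ : _ = (a * a' - b * b') / (- l^-1 * b' * z + a)).
  rewrite [l * _](_ : _ = (a * a' - b * b') * z / (- l^-1 * b' * z + a)).
    by field; rewrite l0 z1 ab0.
  by field; rewrite l0 z1.
by field; rewrite l0 z1.
Qed.

Lemma su11_disk_aut (R : realType) (l a b : R[i]) :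
  `|l| = 1 -> `|b| < `|a| ->
  exists2 g : disk R -> disk R, disk_aut g &
    forall z, b^* * val z + a^* != 0 /\
      val (g z) = l * (a * val z + b) / (b^* * val z + a^*).
Proof.
move=> l1 ab; have lV := unit_conjV l1.
have l0 : l != 0 by rewrite -normr_gt0 l1.
have [g ang gE] := su11_disk_map l1 ab; exists g => //; split=> //.
(* The inverse belongs to the same family, with these parameters. *)
have [||h _ hE] := @su11_disk_map R l^-1 a^* (- l * b).
- by rewrite normfV l1 invr1.
- by rewrite norm_conjC normrM normrN l1 mul1r.
have ab0 : a * a^* - b * b^* != 0.
  by rewrite -!normCK subr_eq0 gt_eqF // ltr_pXn2r // nnegrE.
have lbE : (- l * b)^* = - l^-1 * b^* by rewrite rmorphM rmorphN /= lV.
rewrite lbE conjCK in hE.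
exists h => z; apply: val_inj.
- rewrite (hE (g z)).2 (gE z).2; exact: su11_cancel (gE z).1.
- rewrite (gE (h z)).2 (hE z).2; exact: su11_cancelV (hE z).1.
Qed.

(* Composed with the Cayley transform to the right half-plane, g is the Moebius
   map sending p to 0 and q to infinity. *)
Lemma disk_aut_sending_points (R : realType) (p q : R[i]) :
  `|p| = 1 -> `|q| = 1 -> p != q ->
  exists2 g : disk R -> disk R, disk_aut g &
    forall z, (1 + val (g z)) / (1 - val (g z))
      = (1 - q / p) * ((val z - p) / (q - val z)).
Proof.
move=> p1 q1 pq.
have p0 : p != 0 by rewrite -normr_gt0 p1.
have q0 : q != 0 by rewrite -normr_gt0 q1.
have [pV qV] := (unit_conjV p1, unit_conjV q1).
have sE : (2 - q / p)^* = 2 - p / q.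
  by rewrite rmorphB rmorphM fmorphV /= pV qV rmorph_nat invrK mulrC.
(* Solving [(1 + w) / (1 - w) = (1 - q / p) * ((z - p) / (q - z))] for [w] gives these parameters;
   the factor [1 - q / p] makes the image the right half-plane. *)
have [||g autg gE] := @su11_disk_aut R q^-1 (2 - q / p) (- p).
- by rewrite normfV q1 invr1.
- rewrite normrN p1 -(ltr_pXn2r (n := 2)) // ?nnegrE // expr1n.
  rewrite normCK sE -subr_gt0.
  rewrite (_ : _ - 1 = 2 * `|p - q| ^+ 2); last first.
    by rewrite normCK rmorphB /= pV qV; field; rewrite p0 q0.
  by rewrite mulr_gt0 // exprn_gt0 // normr_gt0 subr_eq0.
have pN : (- p)^* = - p^-1 by rewrite rmorphN /= pV.
exists g => // z; have [] := gE z.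
rewrite sE pN; have qz := disk_neq_unit z q1.
set D := _ + _ => D0 ->; have DE : D = - p^-1 * val z + (2 - p / q) by [].
clearbody D.
rewrite [1 - _](_ : _ = 2 * (q - val z) / (q * D)); last first.
  transitivity ((q * D - ((2 - q / p) * val z - p)) / (q * D)).
    by field; rewrite D0 q0 p0.
  by congr (_ / _); rewrite DE; field; rewrite q0 p0.
rewrite [1 + _](_ : _ = 2 * ((1 - q / p) * (val z - p)) / (q * D)); last first.
  transitivity ((q * D + ((2 - q / p) * val z - p)) / (q * D)).
    by field; rewrite D0 q0 p0.
  by congr (_ / _); rewrite DE; field; rewrite q0 p0.
by field; rewrite D0 qz p0 q0.
Qed.

(** The witness is the inverse Cayley transform; the line of real part 1 is all that
    [gt0_of_half_plane] tests. *)
Lemma cayley_surjective (R : realType) (t : R) :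
  exists z : disk R, (1 + val z) / (1 - val z) = Complex 1 t.
Proof.
set w := Complex 1 t.
have w1 : w + 1 != 0.
  by rewrite eq_complex /= (_ : 1 + 1 = 2 :> R) // pnatr_eq0.
have N : `|(w - 1) / (w + 1)| < 1.
  rewrite normrM normfV ltr_pdivrMr ?normr_gt0 // mul1r.
  rewrite -(ltr_pXn2r (n := 2)) // ?nnegrE // -!add_Re2_Im2 ltcR /=.
  nra.
exists (exist (fun w : R[i] => `|w| < 1) _ N) => /=.
rewrite (_ : 1 - _ = 2 / (w + 1)); last by field.
rewrite (_ : 1 + _ = 2 * w / (w + 1)); last by field.
by field; rewrite w1.
Qed.

(** * Dilations of the half-plane and hyperbolic automorphisms *)

Lemma pow_fun_scale (R : realType) (m t : R) (u v : disk R) : 0 < m ->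
  (1 + val v) / (1 - val v) = m%:C%C * ((1 + val u) / (1 - val u)) ->
  pow_fun t v = cexp ('i%C * (t * ln m)%:C%C) * pow_fun t u.
Proof.
move=> m0 uv; rewrite /pow_fun uv clogM //; last first.
  apply/eqP => u0; have := Re_cayley_gt0 (valP u).
  by rewrite u0 ltxx.
by rewrite mulrDr cexpD rmorphM -!mulrA.
Qed.

Lemma moebius_SomeE (R : realType) (a b c d z w : R[i]) :
  moebius a b c d (Some z) = Some w ->
  c * z + d != 0 /\ w = (a * z + b) / (c * z + d).
Proof. by rewrite /moebius; case: ifPn => // cz [<-]. Qed.

Lemma hyperbolic_half_plane_dilation (R : realType) (phi : disk R -> disk R) :
  hyperbolic phi ->
  exists g : disk R -> disk R, exists2 m : R, 0 < m /\ m != 1 &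
    disk_aut g /\ forall z,
      (1 + val (g (phi z))) / (1 - val (g (phi z)))
      = m%:C%C * ((1 + val (g z)) / (1 - val (g z))).
Proof.
move=> [a [b [c [d [det0 phiE [p [q [/eqP pq p1 q1 fixE]]]]]]]].
have [g autg gE] := disk_aut_sending_points p1 q1 pq.
have p0 : p != 0 by rewrite -normr_gt0 p1 ltr01.
have pq0 : p - q != 0 by rewrite subr_eq0.
have fixP x : [set Some p; Some q] (Some x) -> a * x + b = x * (c * x + d).
  by rewrite -fixE => /moebius_SomeE[cx {2}->]; rewrite divfK.
have fp := fixP p (or_introl erefl).
have fq := fixP q (or_intror erefl).
(* Otherwise infinity would be a fixed point. *)
have c0 : c != 0.
  apply/eqP => c0; have : [set w | moebius a b c d w = w] None.
    by rewrite /= c0 eqxx.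
  by rewrite fixE => -[].
(* Here and in [bE]: Vieta's formulas for the fixed-point equation [c x^2 + (d - a) x - b = 0] with
   roots [p] and [q]. *)
have dE : d = a - c * (p + q).
  apply: (mulfI pq0); apply/eqP; rewrite -subr_eq0; apply/eqP.
  transitivity (p * (c * p + d) - (a * p + b) - (q * (c * q + d) - (a * q + b))).
    by ring.
  by rewrite fp fq !subrr.
have bE : b = - (c * p * q).
  by rewrite -[b](addKr (a * p)) fp dE; ring.
(* The product is the determinant; its factors form the multiplier in [conj]. *)
have : (a - p * c) * (a - q * c) != 0.
  by rewrite (_ : _ * _ = a * d - b * c) // dE bE; ring.
rewrite mulf_eq0 negb_or => /andP[ap0 aq0].
have conj z : (1 + val (g (phi z))) / (1 - val (g (phi z)))
    = (a - p * c) / (a - q * c) * ((1 + val (g z)) / (1 - val (g z))).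
  rewrite !gE.
  have [cz phiz] := moebius_SomeE (phiE z).
  have qz := disk_neq_unit z q1.
  rewrite phiz.
  rewrite (_ : _ - p = (a - p * c) * (val z - p) / (c * val z + d)); last first.
    by move: cz; rewrite dE bE => cz; field.
  rewrite (_ : q - _ / _ = (a - q * c) * (q - val z) / (c * val z + d));
      last first.
    by move: cz; rewrite dE bE => cz; field.
  by field; rewrite p0 cz qz aq0.
have m0 : 0 < (a - p * c) / (a - q * c).
  apply: gt0_of_half_plane => t.
  have [u <-] := cayley_surjective t.
  have [h hK gK] := autg.1.
  rewrite -(gK u) -conj; exact: (Re_cayley_gt0 (valP (g (phi (h u))))).
have mE : (a - p * c) / (a - q * c)
    = (complex.Re ((a - p * c) / (a - q * c)))%:C%C.
  by rewrite RRe_real // realE ltW.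
rewrite mE in m0 conj; exists g, (complex.Re ((a - p * c) / (a - q * c))) => //.
split; first by rewrite -ltcR.
(* Multiplier 1 would give [p * c = q * c], hence [p = q]. *)
apply/eqP => m1; move: mE; rewrite m1 => /(canRL (divfK aq0)).
rewrite mul1r => /addrI/oppr_inj/(mulIf c0)/eqP.
by rewrite (negbTE pq).
Qed.

(** [disk_aut] asks analyticity of the map alone; that of the inverse is read off from the adjugate
    matrix. *)
Lemma moebius_disk_aut_inv (R : realType) (phi psi : disk R -> disk R)
    (a b c d : R[i]) :
  a * d - b * c != 0 ->
  (forall z : disk R, moebius a b c d (Some (val z)) = Some (val (phi z))) ->
  cancel phi psi -> cancel psi phi -> disk_aut psi.
Proof.
move=> det0 phiE phiK psiK; split; first by exists phi.
have psiE z : a - c * val z != 0 /\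
    val (psi z) = (d * val z - b) / (a - c * val z).
  have [] := moebius_SomeE (phiE (psi z)); rewrite psiK => cz ->.
  rewrite (_ : a - _ = (a * d - b * c) / (c * val (psi z) + d)); last by field.
  split; first by rewrite mulf_neq0 // invr_eq0.
  by field; rewrite det0 cz.
apply: (@moebius_analytic _ _ d (- b) (- c) a) => z.
  by rewrite mulNr addrC; have [] := psiE z.
by rewrite mulNr [- _ + a]addrC; have [] := psiE z.
Qed.

(** * The two inclusions between the spectrum and the circle *)

Theorem theorem3p6 (R : realType) (X : banachAnalyticSpace R)
  (hF : calF R `<=` member X)
  (hAut : forall phi : disk R -> disk R, disk_aut phi ->
     [/\ comp_stable X phi, bounded_operator (comp_op X phi)
       & spectral_radius (comp_op X phi) = 1])
  (phi : disk R -> disk R) (hphi : disk_aut phi) (hyp : hyperbolic phi) :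
  spectrum (comp_op X phi) = unit_circle R.
Proof.
have [sphi bphi rphi] := hAut _ hphi.
apply/seteqP; split.
  have [psi phiK psiK] := hphi.1.
  have [a [b [c [d [det0 phiE _]]]]] := hyp.
  have [spsi bpsi rpsi] := hAut _ (moebius_disk_aut_inv det0 phiE phiK psiK).
  by apply: (spectrum_sub_unit_circle bphi bpsi) => //; exact: comp_op_cancel.
move=> l /unit_circle_cexp[t ->].
have [g [m [m0 m1] [autg gE]]] := hyperbolic_half_plane_dilation hyp.
have lnm : ln m != 0 by rewrite ln_eq0.
(* Chosen so that the eigenvalue [m^(is)] is [exp(it)]. *)
pose s := t / ln m.
have [sg _ _] := hAut _ autg.
have /sg[f _ fE] : member X (pow_fun s) by apply: hF; left; right; exists s.
apply: (@eigenvalue_spectrum _ _ _ _ f).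
- by have /zmod_morphism_linear/(_ 0 0) := bphi.1; rewrite !subrr.
(* An exponential never vanishes; evaluation at the centre of the disk shows that [f] is nonzero. *)
- apply/eqP => f0; have O1 : `|0 : R[i]| < 1 by rewrite normr0 ltr01.
  have /(congr1 (fun h => h (exist (fun w : R[i] => `|w| < 1) 0 O1))) := fE.
  by rewrite f0 linear0 /= => /esym/eqP; rewrite (negbTE (cexp_neq0 _)).
- apply: (@fun_of_inj _ X); rewrite fun_of_comp_op // linearZ fE.
  apply/funext => z /=; rewrite (pow_fun_scale _ m0 (gE z)).
  by rewrite /s divfK.
Qed.
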